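(* Let $K_n$ be the complete graph on $n$ vertices. If $n=j^2+\delta$ with $j$ a positive integer and $\delta\in\{-2,0,2\}$, then the cordial vertex deficiency of $K_n$ is $cvd(K_n)=j-1$. If $n$ is not of this form, then $K_n$ is strictly noncordial, i.e. $cvd(K_n)=\infty$.
   Context: Graphs are finite and may have multiple edges but not loops. A binary labeling of a graph $G$ is a function $f:V(G)\to\{0,1\}$. Two real numbers $x,y$ are roughly equal if $0\le |x-y|\le 1$. A binary labeling $f$ is friendly if $|f^{-1}(0)|$ and $|f^{-1}(1)|$ are roughly equal. A binary labeling $f$ induces an edge labeling $f_e:E(G)\to\{0,1\}$ by $f_e(uv)=f(u)+f(v)$ modulo 2. A friendly labeling $f$ of $G$ is cordial if $|f_e^{-1}(0)|$ and $|f_e^{-1}(1)|$ are roughly equal. The cordial vertex deficiency $cvd(G)$ is the minimum, over all binary labelings $f$ of $G$ (not necessarily friendly) for which $|f_e^{-1}(0)|$ and $|f_e^{-1}(1)|$ are roughly equal, of the number of labeled vertices (added as isolated vertices, with labels in $\{0,1\}$ chosen appropriately) that must be added to $G$ so that the resulting labeling of the augmented graph $G'$ is cordial. If no such binary labeling of $G$ exists, $G$ is called strictly noncordial and $cvd(G)=\infty$.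
   Formalization: The claim fails for n = 2 (2 = 2² − 2 predicts cvd(K_2) = 1, but labeling the two vertices 0 and 1 is cordial, so cvd(K_2) = 0) and for the null graph n = 0 (not of the form, yet trivially balanced); it is proved for n ≥ 1, with n ≠ 2 in the first part. *)

(* Defs.v *)
From HB Require Import structures.
From mathcomp Require Import all_boot all_order all_algebra.
From mathcomp Require Import boolp constructive_ereal.
Set Implicit Arguments.
Unset Strict Implicit.
Unset Printing Implicit Defensive.
Import Order.TTheory GRing.Theory Num.Theory.
Local Open Scope ring_scope.

(* Parallel edges are distinct elements of [edge] with the same set of ends;
   requiring exactly two ends rules out loops. *)
Record multigraph := Multigraph {
  vertex : finType;
  edge : finType;
  ends : edge -> {set vertex};
  card_ends : forall e, #|ends e| == 2%N }.

(* The labels 0 and 1 are [false] and [true]. *)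
Definition labeling (G : multigraph) := {ffun vertex G -> bool}.

(* Only ever applied to cardinalities, hence stated over the integers. *)
Definition roughly_equal (x y : int) : bool := 0 <= `|x - y| <= 1.

Definition friendly (G : multigraph) (f : labeling G) : bool :=
  roughly_equal #|f @^-1: [set false]| #|f @^-1: [set true]|.

Definition edge_labeling (G : multigraph) (f : labeling G) :
    {ffun edge G -> bool} :=
  [ffun e => odd (\sum_(v in ends e) f v)].

Definition edge_balanced (G : multigraph) (f : labeling G) : bool :=
  roughly_equal #|edge_labeling f @^-1: [set false]|
                #|edge_labeling f @^-1: [set true]|.

Definition cordial (G : multigraph) (f : labeling G) : bool :=
  friendly f && edge_balanced f.

Definition strictly_noncordial (G : multigraph) : bool :=
  ~~ [exists f : labeling G, edge_balanced f].

Section Augmentation.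
Variables (G : multigraph) (k : nat).

Definition augmented_ends (e : edge G) : {set vertex G + 'I_k} :=
  inl @: ends e.

Lemma card_augmented_ends (e : edge G) : #|augmented_ends e| == 2%N.
Proof. by rewrite card_imset ?card_ends // => u v []. Qed.

(* [G] together with [k] isolated vertices. *)
Definition augmented : multigraph := Multigraph card_augmented_ends.

Definition augmented_labeling (f : labeling G) (g : {ffun 'I_k -> bool}) :
    labeling augmented :=
  [ffun x : vertex G + 'I_k =>
     match x with inl v => f v | inr i => g i end].

End Augmentation.

Definition completable (G : multigraph) (k : nat) : bool :=
  [exists f : labeling G, edge_balanced f &&
    [exists g : {ffun 'I_k -> bool}, cordial (augmented_labeling f g)]].

(* The value is [+oo] exactly for the strictly noncordial graphs, see
   [cvd_eq_pinfty] below. *)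
Definition cvd (G : multigraph) : \bar int :=
  match pselect (exists k, completable G k) with
  | left ex_k => (Posz (ex_minn ex_k))%:E
  | right _ => +oo%E
  end.

Definition complete_graph (n : nat) : multigraph :=
  @Multigraph 'I_n {e : {set 'I_n} | #|e| == 2%N} val (fun e => valP e).

Lemma card_edge_complete_graph (n : nat) :
  #|edge (complete_graph n)| = 'C(n, 2).
Proof.
by rewrite /= card_sig -[in RHS](card_ord n) -card_draws cardsE.
Qed.

Lemma edge_labeling_augmented (G : multigraph) (k : nat) (f : labeling G)
    (g : {ffun 'I_k -> bool}) :
  edge_labeling (augmented_labeling f g) = edge_labeling f.
Proof.
apply/ffunP => e; rewrite !ffunE /= big_imset /=; last by move=> u v _ _ [].
by congr odd; apply: eq_bigr => v _; rewrite ffunE.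
Qed.

Lemma card_augmented_labeling (G : multigraph) (k : nat) (f : labeling G)
    (g : {ffun 'I_k -> bool}) (b : bool) :
  #|augmented_labeling f g @^-1: [set b]| =
  (#|f @^-1: [set b]| + #|g @^-1: [set b]|)%N.
Proof.
rewrite -!sum1_card big_sumType /=; congr addn;
  by apply: eq_bigl => x; rewrite !inE ffunE.
Qed.

Lemma completableP (G : multigraph) :
  (exists k, completable G k) <-> ~~ strictly_noncordial G.
Proof.
rewrite negbK; split=> [[k /existsP[f /andP[bal_f _]]]|/existsP[f bal_f]].
  by apply/existsP; exists f.
pose a b := #|f @^-1: [set b]|; pose c := (a true < a false)%N.
pose g : {ffun 'I_(a (~~ c) - a c)%N -> bool} := [ffun=> c].
exists (a (~~ c) - a c)%N; apply/existsP; exists f; rewrite bal_f /=.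
apply/existsP; exists g; rewrite /cordial /edge_balanced.
rewrite edge_labeling_augmented [X in _ && X]bal_f andbT.
have card_g b : #|g @^-1: [set b]| = if b == c then (a (~~ c) - a c)%N else 0%N.
  case: eqP => [-> | /eqP neq_bc].
    rewrite -[RHS]card_ord -cardsT; congr #|pred_of_set _|.
    by apply/setP => i; rewrite !inE ffunE eqxx.
  apply: eq_card0 => i; rewrite !inE ffunE; apply: negbTE.
  by rewrite eq_sym.
rewrite /friendly !card_augmented_labeling !card_g -/(a true) -/(a false).
have le_a : (a c <= a (~~ c))%N.
  by rewrite /c; case: ltnP => [/ltnW|].
by case: (c) le_a => /= le_a; rewrite addn0 subnKC // /roughly_equal subrr normr0.
Qed.

Lemma cvd_eq_pinfty (G : multigraph) :
  cvd G = +oo%E <-> strictly_noncordial G.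
Proof.
rewrite /cvd; case: pselect => [ex_k|no_k]; split=> //.
  by move=> snc; case/negP: ((completableP G).1 ex_k).
by move=> _; apply: contraT => /completableP.
Qed.

(* Although [2 = 2 ^ 2 - 2], the cordial vertex deficiency of [K_2] is not
   [2 - 1]: labeling its two vertices differently is already cordial. *)
Lemma cvd_complete_graph2 : cvd (complete_graph 2) = 0%E.
Proof.
have comp0 : completable (complete_graph 2) 0.
  pose f : labeling (complete_graph 2) := [ffun i : 'I_2 => i == ord0].
  have bal_f : edge_balanced f.
    rewrite /edge_balanced.
    have := cardsC (edge_labeling f @^-1: [set false]).
    have -> : ~: (edge_labeling f @^-1: [set false]) =
              edge_labeling f @^-1: [set true].
      by apply/setP => e; rewrite !inE; case: (edge_labeling f e).
    rewrite card_edge_complete_graph binn; move: #|_| #|_| => a b.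
    by case: a b => [|[|a]] [|[|b]].
  apply/existsP; exists f; rewrite bal_f /=.
  apply/existsP; exists [ffun=> false]; rewrite /cordial /edge_balanced.
  rewrite edge_labeling_augmented [X in _ && X]bal_f andbT.
  rewrite /friendly !card_augmented_labeling.
  rewrite !(eq_card0 (A := _ @^-1: [set _] : {set 'I_0})) => [|[]//|[]//].
  have card_f b : #|f @^-1: [set b]| = 1%N.
    rewrite -sum1_card big_mkcond !big_ord_recl big_ord0 !inE !ffunE.
    by case: b.
  by rewrite !card_f.
rewrite /cvd; case: pselect => [ex_k|[]]; last by exists 0%N.
by case: ex_minnP => m _ /(_ _ comp0); rewrite leqn0 => /eqP ->.
Qed.

(* Main.v *)
(** Writing a and b for the numbers of vertices of K_n labeled 0 and 1, the
    edges labeled 1 are the a * b edges between the two classes, so that twice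
    the difference between the edge classes is (a - b)^2 - n.  An edge-balanced
    labeling thus exists iff n is within 2 of a square (a - b)^2, necessarily of
    the parity of n.  For n <> 2 this square is unique, so |a - b| = j is forced,
    and restoring friendliness takes exactly j - 1 further vertices. *)
Require Import Defs.
From mathcomp Require Import all_boot all_order all_algebra.
From mathcomp Require Import boolp constructive_ereal.
From mathcomp Require Import zify.
Set Implicit Arguments.
Unset Strict Implicit.
Unset Printing Implicit Defensive.
Import Order.TTheory GRing.Theory Num.Theory.
Local Open Scope ring_scope.

Lemma card_preim_bool (T : finType) (f : {ffun T -> bool}) :
  (#|f @^-1: [set false]| + #|f @^-1: [set true]|)%N = #|T|.
Proof.
rewrite -(cardsC (f @^-1: [set true])) addnC; congr (_ + #|pred_of_set _|)%N.
by apply/setP => x; rewrite !inE; case: (f x).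
Qed.

Lemma exists_card_preim_true (n a : nat) :
  (a <= n)%N -> exists f : {ffun 'I_n -> bool}, #|f @^-1: [set true]| = a.
Proof.
move=> le_an; exists [ffun i : 'I_n => (i < a)%N].
rewrite -sum1_card -[RHS]card_ord -sum1_card (big_ord_widen n (fun=> 1%N)) //.
by apply: eq_bigl => i; rewrite !inE ffunE eqb_id.
Qed.

(** Sending a 0-labeled and a 1-labeled vertex to the set they form is injective, as the labels tell
    the two ends apart, and it reaches exactly the edges with ends of different labels. *)
Lemma card_edge_labeling_true (n : nat) (f : labeling (complete_graph n)) :
  #|edge_labeling f @^-1: [set true]| =
  (#|f @^-1: [set false]| * #|f @^-1: [set true]|)%N.
Proof.
pose pair (p : 'I_n * 'I_n) := [set p.1; p.2].
have sum_pair x y : x != y -> (\sum_(v in pair (x, y)) f v = f x + f y)%N.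
  by move=> neq_xy; rewrite big_setU1 ?big_set1 ?inE.
rewrite -cardsX -(card_imset _ val_inj).
rewrite -(card_in_imset (f := pair)
           (D := setX (f @^-1: [set false]) (f @^-1: [set true]))).
  congr #|pred_of_set _|; apply/setP => s; apply/imsetP/imsetP.
    case=> -[e e2] + ->; rewrite !inE ffunE /=.
    have /cards2P[x [y [neq_xy ->]]] := e2.
    rewrite sum_pair //.
    case fx: (f x); case fy: (f y) => // _.
      by exists (y, x); rewrite ?inE ?fx ?fy // /pair setUC.
    by exists (x, y); rewrite ?inE ?fx ?fy.
  case=> -[x y] /=; rewrite !inE /= => /andP[/eqP fx /eqP fy] ->.
  have neq_xy : x != y by apply: contra_eq_neq fx => ->; rewrite fy.
  have xy2 : #|pair (x, y)| == 2%N by rewrite cards2 neq_xy.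
  by exists (exist (fun e : {set 'I_n} => #|e| == 2%N) _ xy2);
    rewrite // !inE ffunE /= sum_pair // fx fy.
move=> [x y] [x' y']; rewrite !inE /=.
move=> /andP[/eqP fx /eqP fy] /andP[/eqP fx' /eqP fy'] /setP eq_xy.
have:= eq_xy x; have:= eq_xy y; rewrite !inE !eqxx orbT /=.
case: eqP => [yx'|_ /esym /eqP->]; first by rewrite yx' fx' in fy.
by case: eqP => [->|_ /esym /eqP xy']; last by rewrite xy' fy' in fx.
Qed.

(** Besides relating squares to edge counts, this tells [lia] that a square has the parity of its
    root. *)
Lemma sqrn_bin2 (n : nat) : (n ^ 2 = n + 'C(n, 2).*2)%N.
Proof. by elim: n => // n IHn; rewrite binS bin1 -addn1 sqrnD IHn; lia. Qed.

Lemma edge_balanced_complete_graph (n : nat) (f : labeling (complete_graph n)) :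
  edge_balanced f =
  (`|(#|f @^-1: [set false]|%:Z - #|f @^-1: [set true]|%:Z) ^+ 2 - n%:Z| <= 2).
Proof.
rewrite /edge_balanced /roughly_equal.
have := card_preim_bool (edge_labeling f); rewrite card_edge_complete_graph.
have := card_preim_bool f; rewrite card_ord card_edge_labeling_true.
move: #|_| #|_| #|_| => c b a ab e.
have := sqrn_bin2 n; rewrite -e -ab -!mulnn normr_ge0 /= => sq_ab.
have -> : (a%:Z - b%:Z) ^+ 2 - (a + b)%N%:Z = 2 * (c%:Z - (a * b)%N%:Z) by lia.
lia.
Qed.

(** Only the sizes of the label classes matter, [a], [b] in the graph and [c], [d] among the added
    vertices, and all sizes with the right sums are realized. *)
Lemma completable_complete_graphP (n k : nat) :
  completable (complete_graph n) k <->
  exists a b c d : nat,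
    [/\ (a + b)%N = n, (c + d)%N = k, `|(a%:Z - b%:Z) ^+ 2 - n%:Z| <= 2 &
        roughly_equal (a + c)%N (b + d)%N].
Proof.
split.
  case/existsP=> f /andP[bal_f /existsP[g /andP[fr _]]].
  exists #|f @^-1: [set false]|, #|f @^-1: [set true]|.
  exists #|g @^-1: [set false]|, #|g @^-1: [set true]|.
  rewrite !card_preim_bool !card_ord -edge_balanced_complete_graph.
  by rewrite -!card_augmented_labeling.
move=> [a [b [c [d [ab cd bal fr]]]]].
have [|f fb] := @exists_card_preim_true n b; first by lia.
have [|g gd] := @exists_card_preim_true k d; first by lia.
have fa : #|f @^-1: [set false]| = a.
  by have := card_preim_bool f; rewrite card_ord fb -[RHS]ab => /addIn.
have gc : #|g @^-1: [set false]| = c.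
  by have := card_preim_bool g; rewrite card_ord gd -[RHS]cd => /addIn.
have bal_f : edge_balanced (f : labeling (complete_graph n)).
  by rewrite edge_balanced_complete_graph fa fb.
apply/existsP; exists f; rewrite bal_f /=.
apply/existsP; exists g.
rewrite /cordial /edge_balanced edge_labeling_augmented [X in _ && X]bal_f.
by rewrite andbT /friendly !card_augmented_labeling fa fb gc gd.
Qed.

Lemma near_square_split (n j : nat) (delta : int) :
  (0 < j)%N -> delta \in [:: -2; 0; 2] -> n%:Z = j%:Z ^+ 2 + delta ->
  exists b : nat, (b + (b + j))%N = n.
Proof.
move=> j_gt0; rewrite !inE => delta_in nE.
have := sqrn_bin2 j; set q := 'C(j, 2) => qE.
(* Hence n >= 2j - 3, and n has the parity of j, which together give j <= n. *)
have le_2j : (2 * j <= j ^ 2 + 1)%N by nia.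
by exists (n - j)./2; lia.
Qed.

(** The difference |a - b| and its square have the parity of a + b, so the offset from the square is
    even. The witness [m] is the smaller class size. *)
Lemma near_square_delta (a b : nat) :
  `|(a%:Z - b%:Z) ^+ 2 - (a + b)%N%:Z| <= 2 ->
  exists d m : nat, exists delta : int,
    [/\ `|a%:Z - b%:Z| = d, delta \in [:: -2; 0; 2], (a + b = d + m.*2)%N &
        (a + b)%N%:Z = d%:Z ^+ 2 + delta].
Proof.
move=> bal; exists `|a%:Z - b%:Z|%N, (minn a b).
exists ((a + b)%N%:Z - (a%:Z - b%:Z) ^+ 2).
have sqE : (`|a%:Z - b%:Z|%N)%:Z ^+ 2 = (a%:Z - b%:Z) ^+ 2.
  by rewrite abszE real_normK ?num_real.
have := sqrn_bin2 `|a%:Z - b%:Z|%N; set q := 'C(_, 2) => qE.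
rewrite sqE !inE; split; [by rewrite abszE | | lia | lia].
by move: bal; rewrite -sqE; lia.
Qed.

(* For [n = 2] both [0] and [2] qualify as the difference. *)
Lemma near_square_unique (a b j : nat) (delta : int) :
  (a + b)%N <> 2%N -> (0 < j)%N -> delta \in [:: -2; 0; 2] ->
  (a + b)%N%:Z = j%:Z ^+ 2 + delta ->
  `|(a%:Z - b%:Z) ^+ 2 - (a + b)%N%:Z| <= 2 -> `|a%:Z - b%:Z| = j.
Proof.
move=> ab_neq2 j_gt0 delta_in abE.
case/near_square_delta=> d [m [delta' [-> delta'_in abd abE']]].
have [c abj] := near_square_split j_gt0 delta_in abE.
congr Posz; move: delta_in delta'_in; rewrite !inE => delta_in delta'_in.
have [lt_dj|lt_jd|//] := ltngtP d j.
  (* By parity the roots differ by at least 2, so their squares differ by at least 4d + 4. Two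
     squares within 2 of n differ by at most 4, so d = 0; then n = 2, which is excluded. *)
  have le_dj : (d + 2 <= j)%N by lia.
  have : ((d + 2) ^ 2 <= j ^ 2)%N by rewrite leq_exp2r.
  rewrite sqrnD => le_sq; have d0 : d = 0%N by lia.
  by rewrite d0 expr0n /= in abE'; lia.
(* Now the smaller root j is positive, so the gap of at least 4j + 4 is already too large. *)
have le_jd : (j + 2 <= d)%N by lia.
have : ((j + 2) ^ 2 <= d ^ 2)%N by rewrite leq_exp2r.
by rewrite sqrnD; lia.
Qed.

Lemma near_square_form (a b : nat) :
  (0 < a + b)%N -> `|(a%:Z - b%:Z) ^+ 2 - (a + b)%N%:Z| <= 2 ->
  exists (j : nat) (delta : int),
    [/\ (0 < j)%N, delta \in [:: -2; 0; 2] &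
        (a + b)%N%:Z = j%:Z ^+ 2 + delta].
Proof.
move=> ab_gt0 /near_square_delta[[|d] [m [delta [_ delta_in _ abE]]]].
  (* Equal classes would need j = 0; this happens only for n = 2, which is also 2^2 - 2. *)
  exists 2%N, (-2); split=> //; move: delta_in; rewrite !inE => delta_in.
  by rewrite expr0n /= in abE; lia.
by exists d.+1, delta.
Qed.

Theorem theorem3 (n : nat) (n_gt0 : (0 < n)%N) :
  (n <> 2%N ->
   forall (j : nat) (delta : int),
     (0 < j)%N -> delta \in [:: -2; 0; 2] -> n%:Z = j%:Z ^+ 2 + delta ->
     cvd (complete_graph n) = (j%:Z - 1)%:E)
  /\
  (~ (exists (j : nat) (delta : int),
        [/\ (0 < j)%N, delta \in [:: -2; 0; 2] &
            n%:Z = j%:Z ^+ 2 + delta]) ->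
   strictly_noncordial (complete_graph n) /\
   cvd (complete_graph n) = +oo%E).
Proof.
split=> [n_neq2 j delta j_gt0 delta_in nE | no_form]; last first.
  have snc : strictly_noncordial (complete_graph n).
    apply: contraT => /completableP[k].
    case/completable_complete_graphP=> a [b [_ [_ [ab _ bal _]]]].
    by case: no_form; subst n; exact: near_square_form n_gt0 bal.
  by split=> //; apply/cvd_eq_pinfty.
have comp : completable (complete_graph n) j.-1.
  apply/completable_complete_graphP.
  have [b bE] : exists b, (b + (b + j))%N = n.
    exact: near_square_split j_gt0 delta_in nE.
  (* All added vertices join the smaller class; one fewer than j suffices, since a final difference
     of 1 is allowed. *)
  exists (b + j)%N, b, 0%N, j.-1; rewrite /roughly_equal.
  split; [lia | lia | | lia].
  have -> : (b + j)%N%:Z - b%:Z = j%:Z by lia.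
  by move: delta_in; rewrite !inE; lia.
rewrite /cvd; case: pselect => [ex_k|[]]; last by exists j.-1.
case: ex_minnP => m /completable_complete_graphP[a [b [c [d [ab cd bal fr]]]]].
move=> /(_ _ comp) le_m.
suff : (j.-1 <= m)%N by move=> ge_m; congr EFin; lia.
(* The initial difference is j, and each added vertex lowers it by at most 1. *)
subst n; have := near_square_unique n_neq2 j_gt0 delta_in nE bal.
by move: fr; rewrite /roughly_equal; lia.
Qed.
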